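(* For every composition $\lambda$ of $n$, the set $C_\lambda\subseteq S_n$, equipped with the restriction of the Bruhat-Chevalley ordering of $S_n$, is a graded poset having a unique minimum element and a unique maximum element.
   Context: $S_n$ is the symmetric group on $[n]=\{1,\dots,n\}$. The standard cyclic form of $\pi\in S_n$ is its expression as a product of disjoint cycles $(a_{1,1},\dots,a_{k_1,1})(a_{1,2},\dots,a_{k_2,2})\cdots(a_{1,m},\dots,a_{k_m,m})$, where cycles of length one are NOT omitted, each cycle is written starting with its smallest entry ($a_{1,j}<a_{i,j}$ for $i\ge 2$), and cycles are ordered by increasing first entries ($a_{1,1}<a_{1,2}<\cdots<a_{1,m}$). The composition type of $\pi$ is the composition $(k_1,\dots,k_m)$ of $n$ formed by the cycle lengths in this order. The map $\Omega:S_n\to S_n$ sends $\pi$ to the permutation whose one-line notation $[\pi'(1),\dots,\pi'(n)]$ is the word obtained by deleting the parentheses from the standard cyclic form of $\pi$. For a composition $\lambda\vDash n$, $A_\lambda$ is the set of permutations of composition type $\lambda$ and $C_\lambda:=\Omega(A_\lambda)$. For $x\in S_n$, $inv(x)=|\{(i,j):1\le i<j\le n,\ x(i)>x(j)\}|$. The Bruhat-Chevalley order on $S_n$ is the transitive closure of the relations $x<y$ where $y$ is obtained from $x=[a_1,\dots,a_n]$ by swapping entries $a_i<a_j$ at positions $i<j$ and $inv(y)=inv(x)+1$. A finite poset is graded if all maximal chains have the same length. *)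

(* Defs.v *)
From mathcomp Require Import all_boot fingroup perm.

Set Implicit Arguments.
Unset Strict Implicit.
Unset Printing Implicit Defensive.

(* The letters 1, ..., n are the ordinals 0, ..., n - 1 of 'I_n. *)

Definition is_composition (n : nat) (lambda : seq nat) : bool :=
  all (fun k => 0 < k) lambda && (sumn lambda == n).

Section Permutations.

Variable n : nat.
Implicit Types (s x y : 'S_n) (i j : 'I_n).

Definition is_cycle_min s i : bool := [forall j in porbit s i, i <= j].

(* The cycle (a, s a, s (s a), ...), as a word beginning with a. *)
Definition cycle_word s i : seq 'I_n := traject s i #|porbit s i|.

(* As enum 'I_n is increasing, the cycles come in the order of their smallest
   entries; fixed points give words of length 1. *)
Definition standard_cyclic_form s : seq (seq 'I_n) :=
  [seq cycle_word s i | i <- enum 'I_n & is_cycle_min s i].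

Definition composition_type s : seq nat := shape (standard_cyclic_form s).

Definition cyclic_word s : seq 'I_n := flatten (standard_cyclic_form s).

Lemma mem_cycle_word s i : cycle_word s i =i porbit s i.
Proof. by move=> j; rewrite porbit_traject. Qed.

Lemma mem_cyclic_word s i : i \in cyclic_word s.
Proof.
have [j /= sj min_j] :=
  @arg_minnP _ i [pred j | j \in porbit s i] (fun j => val j) (porbit_id s i).
apply/flattenP; exists (cycle_word s j); last first.
  by rewrite mem_cycle_word porbit_sym.
rewrite map_f // mem_filter mem_enum andbT.
apply/forall_inP=> k; rewrite -eq_porbit_mem => /eqP sk; apply: min_j.
by rewrite /= -eq_porbit_mem sk eq_porbit_mem.
Qed.

Lemma cyclic_word_uniq s : uniq (cyclic_word s).
Proof.
rewrite /cyclic_word /standard_cyclic_form.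
have: uniq [seq i <- enum 'I_n | is_cycle_min s i].
  by rewrite filter_uniq ?enum_uniq.
have: all (is_cycle_min s) [seq i <- enum 'I_n | is_cycle_min s i].
  exact: filter_all.
elim: [seq i <- _ | _] => //= i r IHr /andP[min_i min_r] /andP[r'i Ur].
rewrite cat_uniq uniq_traject_porbit IHr // andbT /=.
apply/hasPn=> k /flattenP[_ /mapP[j rj ->]].
rewrite mem_cycle_word -eq_porbit_mem => /eqP kj.
apply: contra r'i; rewrite [k \in _]mem_cycle_word -eq_porbit_mem kj => /eqP ij.
have min_j := allP min_r j rj.
suff -> : i = j by [].
apply/val_inj/eqP; rewrite eqn_leq.
by rewrite (forall_inP min_i) -?ij ?porbit_id // (forall_inP min_j) // ij porbit_id.
Qed.

Lemma size_cyclic_word s : size (cyclic_word s) == n.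
Proof.
rewrite -(card_uniqP (cyclic_word_uniq s)) -[X in _ == X]card_ord.
by apply/eqP/eq_card=> i; rewrite mem_cyclic_word.
Qed.

Definition cyclic_tuple s : n.-tuple 'I_n := Tuple (size_cyclic_word s).

Lemma cyclic_tuple_inj s : injective (tnth (cyclic_tuple s)).
Proof. by apply/tuple_uniqP; exact: cyclic_word_uniq. Qed.

Definition Omega s : 'S_n := perm (@cyclic_tuple_inj s).

Definition one_line x : seq 'I_n := [seq x i | i <- enum 'I_n].

Lemma one_line_Omega s : one_line (Omega s) = cyclic_word s.
Proof.
rewrite /one_line (eq_map (permE (@cyclic_tuple_inj s))).
by rewrite (map_tnth_enum (cyclic_tuple s)).
Qed.

Definition A_ (lambda : seq nat) : {set 'S_n} :=
  [set s | composition_type s == lambda].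

Definition C_ (lambda : seq nat) : {set 'S_n} := Omega @: A_ lambda.

Definition inv x : nat := #|[set p : 'I_n * 'I_n | p.1 < p.2 & x p.1 > x p.2]|.

(* (tperm i j * x) k = x (tperm i j k): the product exchanges the entries of
   the one-line notation of x at positions i and j. *)
Definition bruhat_step x y : bool :=
  [exists i : 'I_n, exists j : 'I_n,
    [&& i < j, x i < x j, y == (tperm i j * x)%g & inv y == (inv x).+1]].

(* The non-strict order: the reflexive transitive closure of bruhat_step. *)
Definition bruhat_le : rel 'S_n := connect bruhat_step.

End Permutations.

Arguments C_ : clear implicits.
Arguments bruhat_le : clear implicits.

Section Posets.

Variables (T : finType) (le : rel T) (P : {set T}).

Definition partial_order_on : Prop :=
  [/\ {in P, reflexive le}, {in P &, antisymmetric le}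
    & {in P & &, transitive le}].

Definition is_chain (S : {set T}) : bool :=
  (S \subset P) && [forall x in S, forall y in S, le x y || le y x].

Definition maximal_chain (S : {set T}) : bool := maxset is_chain S.

Definition chain_length (S : {set T}) : nat := #|S|.-1.

Definition graded_poset : Prop :=
  partial_order_on /\
  forall S S' : {set T}, maximal_chain S -> maximal_chain S' ->
    chain_length S = chain_length S'.

Definition is_minimum (m : T) : Prop := m \in P /\ {in P, forall x, le m x}.

Definition is_maximum (m : T) : Prop := m \in P /\ {in P, forall x, le x m}.

End Posets.

(* Main.v *)
(** Cut the positions into consecutive blocks of sizes [lambda].  Then [C_ n lambda]
    is the set of words whose entry at each block start is smaller than all later
    entries.  A Bruhat cover exchanging positions [a < b] stays in this set as soon
    as [a] is not a block start.  If [x < y] are both in the set, their first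
    difference [a] is not a block start (there both entries would be the least
    remaining letter), so the exchange at [a] from the proof of the tableau
    criterion yields a cover [z <= y] of [x] inside the set; hence the set is graded
    by the number of inversions.  An element with no ascent from a position that is
    not a block start has a prescribed inversion set; every element lies below such
    an element, which is therefore the maximum. *)

From mathcomp Require Import all_boot fingroup perm zify.
Require Import Defs.

Set Implicit Arguments.
Unset Strict Implicit.
Unset Printing Implicit Defensive.

(** * Gradedness of a finite poset from a rank function *)

Section GradedByRank.

Variables (T : finType) (le : rel T) (P : {set T}) (rk : T -> nat).
Hypotheses (le_refl : reflexive le) (le_trans : transitive le).
Hypothesis le_rk : forall x y, le x y -> rk x <= rk y.
Hypothesis le_rk_eq : forall x y, le x y -> rk x = rk y -> x = y.
Hypothesis cover_below : forall x y, x \in P -> y \in P -> le x y -> x != y ->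
  exists z, [/\ z \in P, le x z, le z y & rk z = (rk x).+1].
Variables m M : T.
Hypotheses (min_m : is_minimum le P m) (max_M : is_maximum le P M).

Lemma le_rank_antisym : antisymmetric le.
Proof.
move=> x y /andP[xy yx]; apply: (le_rk_eq xy).
by apply/eqP; rewrite eqn_leq !le_rk.
Qed.

Lemma maximal_chain_absorb S z : maximal_chain le P S -> z \in P ->
  (forall u, u \in S -> le u z || le z u) -> z \in S.
Proof.
case/maxsetP=> /andP[SP /forall_inP chS] maxS Pz cmp_z.
rewrite -(maxS (z |: S)) ?setU11 ?subsetUr //.
apply/andP; split; first by rewrite subUset sub1set Pz.
apply/forall_inP=> u /setU1P[->|Su]; apply/forall_inP=> v /setU1P[->|Sv].
- by rewrite le_refl.
- by rewrite orbC cmp_z.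
- exact: cmp_z.
- exact: (forall_inP (chS u Su)).
Qed.

(** Induction on [k]. From [x] in the chain of rank [k], let [y] be a chain element of least rank
    above [k]. The cover [z] of [x] below [y] is comparable with the whole chain: elements of rank
    at most [k] lie below [x], the others above [y]. Maximality puts [z] in the chain. *)
Lemma maximal_chain_rank S k : maximal_chain le P S -> rk m <= k <= rk M ->
  exists2 x, x \in S & rk x = k.
Proof.
move=> maxS; have [/andP[/subsetP SP /forall_inP chS] _] := maxsetP maxS.
have Sm : m \in S.
  by apply: (maximal_chain_absorb maxS min_m.1) => u /SP/min_m.2->; rewrite orbT.
have SM : M \in S.
  by apply: (maximal_chain_absorb maxS max_M.1) => u /SP/max_M.2->.
have leS u v : u \in S -> v \in S -> rk u <= rk v -> le u v.
  move=> Su Sv uv; case/orP: (forall_inP (chS u Su) v Sv) => // vu.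
  by rewrite (le_rk_eq vu) ?le_refl //; have := le_rk vu; lia.
elim: k => [|k IHk] /andP[mk kM].
  by exists m => //; lia.
(* When [k.+1] is already the bottom rank, the induction hypothesis does not apply. *)
have [mk1|] := eqVneq (rk m) k.+1; first by exists m.
move=> nmk; have [|x Sx xk] := IHk; first by lia.
have SMk : (M \in S) && (k < rk M) by rewrite SM.
have [y /andP[Sy ky] miny] :=
  @arg_minnP _ M [pred y | (y \in S) && (k < rk y)] rk SMk.
have [||||z [Pz xz zy zk]] := @cover_below x y; try exact: SP.
- by apply: leS => //; lia.
- by apply/eqP=> xy; move: ky; rewrite -xy; lia.
exists z; last by lia.
apply: (maximal_chain_absorb maxS Pz) => u Su.
have [uk|ku] := leqP (rk u) k.
  by rewrite (le_trans _ xz) // leS // xk.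
by rewrite (le_trans zy) ?orbT // leS // miny //= Su.
Qed.

(** The rank maps a maximal chain bijectively onto the interval from [rk m] to [rk M]; [f] is this
    map shifted to start at 0. *)
Lemma maximal_chain_card S :
  maximal_chain le P S -> #|S| = (rk M - rk m).+1.
Proof.
move=> maxS; have [/andP[/subsetP SP /forall_inP chS] _] := maxsetP maxS.
have mM : rk m <= rk M by apply: le_rk; apply: min_m.2 max_M.1.
have rkS u : u \in S -> rk m <= rk u <= rk M.
  by move/SP=> Pu; rewrite !le_rk ?min_m.2 ?max_M.2.
pose f u : 'I_(rk M - rk m).+1 := inord (rk u - rk m).
have fE u : u \in S -> f u = rk u - rk m :> nat.
  by move/rkS=> uS; rewrite inordK //; lia.
rewrite -[RHS]card_ord -(card_in_imset (f := f) (D := S)).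
  rewrite -cardsT; congr #|pred_of_set _|; apply/setP=> k; rewrite inE.
  have /(maximal_chain_rank maxS)[x Sx xk] : rk m <= rk m + k <= rk M.
    by have := ltn_ord k; lia.
  by apply/imsetP; exists x => //; apply/val_inj; rewrite /= fE // xk; lia.
move=> u v Su Sv /(congr1 val); rewrite /= !fE // => uv.
have {}uv : rk u = rk v by have := rkS u Su; have := rkS v Sv; lia.
by case/orP: (forall_inP (chS u Su) v Sv) => /le_rk_eq ->.
Qed.

Lemma graded_by_rank : graded_poset le P.
Proof.
split; last by move=> S S' /maximal_chain_card cS /maximal_chain_card cS';
  rewrite /chain_length cS cS'.
split=> [x _ | x y _ _ | y x z _ _ _].
- exact: le_refl.
- exact: le_rank_antisym.
- exact: le_trans.
Qed.

End GradedByRank.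

(** * Bruhat covers and the tableau criterion *)

Section Bruhat.

Variable n : nat.
Implicit Types (x y z : 'S_n) (a b i j p q : 'I_n).

Lemma tperm_cases x a b p : a != b ->
  [\/ p = a /\ tperm a b p = b, p = b /\ tperm a b p = a
    | [/\ p != a :> nat, p != b :> nat, x p != x a :> nat, x p != x b :> nat
        & tperm a b p = p]].
Proof.
case: tpermP => [->|->|/eqP pa /eqP pb] ab;
  [by constructor 1 | by constructor 2 | constructor 3].
by rewrite !(inj_eq val_inj) !(inj_eq perm_inj).
Qed.

(** The involution [g] applies the transposition to a pair of positions unless that reverses their
    order. It matches the inversions of [z] other than [(a, b)] with those of [x]: the other
    reversed pairs [(a, p)] and [(p, b)], with [a < p < b], keep their status because [x p] is not
    between [x a] and [x b]. *)
Lemma inv_tperm x a b : a < b -> x a < x b ->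
  (forall p, a < p < b -> ~~ (x a < x p < x b)) ->
  inv (tperm a b * x)%g = (inv x).+1.
Proof.
move=> ab xab nob; set z := (_ * x)%g; pose t := tperm a b.
have zE p : z p = x (t p) by rewrite permM.
have nab : a != b by rewrite neq_ltn ab.
pose g (u : 'I_n * 'I_n) :=
  if (u.1 < u.2) == (t u.1 < t u.2) then (t u.1, t u.2) else u.
have gK : involutive g.
  move=> [i j]; case e: ((i < j) == (t i < t j)); rewrite /g /= e /= ?e //.
  by rewrite !tpermK eq_sym e.
have <- : #|g @^-1: [set u : 'I_n * 'I_n | u.1 < u.2 & x u.1 > x u.2]| = inv x.
  exact: card_preimset (inv_inj gK).
rewrite /inv (cardsD1 (a, b)) inE /= ab !zE tpermL tpermR xab add1n; congr _.+1.
apply: eq_card => -[i j]; rewrite !inE /= /g xpair_eqE /=.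
rewrite !zE.
move: (nob i) (nob j); rewrite /t -!val_eqE /=.
have [[-> ->]|[-> ->]|[ia ib xia xib ->]] := tperm_cases x i nab;
  have [[-> ->]|[-> ->]|[ja jb xja xjb ->]] := tperm_cases x j nab;
  rewrite ?eqxx /=; try case: ifP => ?; rewrite /=; lia.
Qed.

(** These are the entries of the rank matrix in the tableau criterion, with letters counted from
    above so that going up in the order increases them. *)
Definition rank_count x (i k : nat) : nat :=
  \sum_(p : 'I_n) ((p <= i) && (k <= x p)).

Definition dominated x y : Prop :=
  forall i k, rank_count x i k <= rank_count y i k.

Lemma rank_count_tperm x a b i k : a < b -> x a < x b ->
  rank_count (tperm a b * x)%g i k =
  rank_count x i k + ((a <= i < b) && (x a < k <= x b)).
Proof.
move=> ab xab; have nba : b != a by rewrite neq_ltn ab orbT.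
rewrite /rank_count (bigD1 a) // (bigD1 b) //=.
rewrite [in RHS](bigD1 a) // [in RHS](bigD1 b) //=.
rewrite !permM tpermL tpermR.
rewrite (eq_bigr (fun p : 'I_n => ((p <= i) && (k <= x p)) : nat)); first by lia.
by move=> p /andP[pa pb]; rewrite permM tpermD // eq_sym.
Qed.

Lemma bruhat_le_dominated x y : bruhat_le n x y -> dominated x y.
Proof.
case/connectP=> s; elim: s x => [|z s IHs] x /=; first by move=> _ -> i k.
case/andP=> /existsP[a /existsP[b /and4P[ab xab /eqP-> _]]].
move=> /IHs{}IHs /IHs{}IHs i k; apply: leq_trans (IHs i k).
by rewrite rank_count_tperm // leq_addr.
Qed.

Lemma first_difference x y : x != y ->
  exists2 a, x a != y a & forall p, p < a -> x p = y p.
Proof.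
move=> nxy; have /existsP[c xyc] : [exists c, x c != y c].
  apply: contraNT nxy; rewrite negb_exists => /forallP xy.
  by apply/eqP/permP=> c; have /eqP := negbNE (xy c).
have [a xya min_a] := @arg_minnP _ c (fun c => x c != y c) val xyc.
exists a => // p; rewrite ltnNge; apply: contraNeq; exact: min_a.
Qed.

Lemma position_after_agreement x y a : (forall p, p < a -> x p = y p) ->
  x a != y a -> exists2 b : 'I_n, a < b & x b = y a.
Proof.
move=> agree nxya; exists (x^-1 (y a))%g; last by rewrite permKV.
rewrite ltn_neqAle leqNgt; apply/andP; split.
  by apply: contra nxya => /eqP/val_inj {1}->; rewrite permKV.
apply/negP=> /[dup] lt_a /agree; rewrite permKV => /perm_inj e.
by rewrite -e ltnn in lt_a.
Qed.

(* Here [a] is the first difference of [x] and [y], and [b] the first later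
   position with [x a < x b <= y a]; [c] witnesses that [y a] is not the least
   remaining letter. *)
Lemma dominated_exchange x y : dominated x y -> x != y ->
  exists a, exists b : 'I_n, [/\ a < b, x a < x b,
    forall p, a < p < b -> ~~ (x a < x p < x b),
    exists2 c : 'I_n, a < c & y c < y a & dominated (tperm a b * x)%g y].
Proof.
move=> dom /first_difference[a nxya agree].
have xya : x a < y a.
  (* If [y a < x a], then at [(a, x a)] the position [a] counts for [x] but not for [y], while all
     earlier positions count equally, against domination. *)
  rewrite ltn_neqAle nxya leqNgt; apply/negP=> yxa.
  have := dom a (x a); rewrite /rank_count (bigD1 a) //= [leqRHS](bigD1 a) //=.
  rewrite !leqnn [x a <= y a]leqNgt yxa /= leqNgt ltnS; apply/negP/negPn.
  apply: leq_sum => p pa; case: (ltngtP p a) => [/agree -> | | /val_inj e] //.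
  by rewrite e eqxx in pa.
have [b0 ab0 xb0] := position_after_agreement agree nxya.
have Qb0 : (a < b0) && (x a < x b0 <= y a) by rewrite ab0 xb0 xya leqnn.
have [b /and3P[ab xab xby] min_b] :=
  @arg_minnP _ b0 (fun b => (a < b) && (x a < x b <= y a)) val Qb0.
have nob p : a < p < b -> ~~ (x a < x p <= y a).
  case/andP=> ap pb; apply/negP=> xp; have := min_b p.
  by rewrite ap xp leqNgt pb => /(_ isT).
exists a, b; split=> //.
- by move=> p /nob; apply: contra => /andP[-> /=]; lia.
- have [||c ac yc] := @position_after_agreement y x a.
  + by move=> p /agree.
  + by rewrite eq_sym.
  by exists c; rewrite ?yc.
move=> i k; rewrite rank_count_tperm //.
case: (boolP (_ && _)) => [|_]; last by rewrite addn0.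
(* In this rectangle the exchange adds one. Letters above [y a] are handled by domination. Among
   letters from [k] to [y a], position [a] counts for [y] only, earlier positions agree, and by the
   choice of [b] no position of [x] strictly between [a] and [b] counts. *)
case/andP=> /andP[ai ib] /andP[xak kxb].
have split_count w : rank_count w i k = rank_count w i (y a).+1 +
    \sum_(p : 'I_n) ((p <= i) && (k <= w p <= y a)).
  by rewrite /rank_count -big_split; apply: eq_bigr => p _ /=; lia.
rewrite !split_count -addnA leq_add //.
rewrite (bigD1 a) //= [leqRHS](bigD1 a) //= [k <= x a]leqNgt xak andbF.
rewrite ai leqnn (leq_trans kxb xby) add0n addnC leq_add2l.
apply: leq_sum => p pa; case: (ltngtP p a) => [/agree->//|ap|/val_inj e].
  by have := nob p; lia.
by rewrite e eqxx in pa.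
Qed.

Lemma bruhat_step_tperm x a b : a < b -> x a < x b ->
  (forall p, a < p < b -> ~~ (x a < x p < x b)) ->
  bruhat_step x (tperm a b * x)%g.
Proof.
move=> ab xab nob; apply/existsP; exists a; apply/existsP; exists b.
by rewrite ab xab eqxx inv_tperm ?eqxx.
Qed.

Lemma inv_step x y : bruhat_step x y -> inv y = (inv x).+1.
Proof. by case/existsP=> a /existsP[b /and4P[_ _ _ /eqP]]. Qed.

(** Upward induction terminates because [inv] is bounded by the number of pairs of positions. *)
Lemma inv_ind (Q : 'S_n -> Prop) :
  (forall x, (forall y, inv y = (inv x).+1 -> Q y) -> Q x) -> forall x, Q x.
Proof.
move=> IH x; have [k] := ubnP (#|{: 'I_n * 'I_n}| - inv x).
elim: k x => // k IHk x xk; apply: IH => y yx; apply: IHk.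
have : inv y <= #|{: 'I_n * 'I_n}| := max_card _.
lia.
Qed.

(** This is the tableau criterion. For the converse, [dominated_exchange] climbs from [x] by covers
    that remain dominated by [y]. *)
Lemma bruhat_leP x y : reflect (dominated x y) (bruhat_le n x y).
Proof.
apply: (iffP idP); first exact: bruhat_le_dominated.
elim/inv_ind: x => x IHx dom; have [->|nxy] := eqVneq x y; first exact: connect0.
have [a [b [ab xab nob _ domz]]] := dominated_exchange dom nxy.
have st := bruhat_step_tperm ab xab nob.
by apply: connect_trans (connect1 st) _; apply: IHx => //; apply: inv_step.
Qed.

Lemma bruhat_le_inv x y : bruhat_le n x y -> inv x <= inv y ?= iff (x == y).
Proof.
case/connectP=> s; elim: s x => [|z s IHs] x /=.
  by move=> _ ->; split; rewrite ?eqxx.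
case/andP=> /inv_step xz /IHs{}IHs /IHs[zy _].
split; first by lia.
by have [exy|] := eqVneq x y; [rewrite exy in xz | ]; lia.
Qed.

Lemma bruhat_le1 x : bruhat_le n 1%g x.
Proof.
apply/bruhat_leP=> i k.
have compl w : rank_count w i k + \sum_(p : 'I_n) ((p <= i) && (w p < k)) =
    \sum_(p : 'I_n) (p <= i).
  by rewrite /rank_count -big_split; apply: eq_bigr => p _ /=; lia.
(* If [k] exceeds [i.+1], the identity has no letter to count. Otherwise its first [i.+1] positions
   contain every letter below [k], the most possible, so its complementary count is the largest. *)
have [ki|ik] := leqP k i.+1; last first.
  by rewrite [rank_count 1 i k]big1 // => p _; rewrite perm1; lia.
suff: \sum_(p : 'I_n) ((p <= i) && (x p < k)) <=
      \sum_(p : 'I_n) ((p <= i) && ((1 : 'S_n)%g p < k)).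
  by have := compl x; have := compl 1%g; lia.
apply: (@leq_trans (\sum_(p : 'I_n) (x p < k))).
  by apply: leq_sum => p _; lia.
rewrite -(reindex_inj (@perm_inj _ x) (P := xpredT)
  (F := fun p : 'I_n => (p < k) : nat)) /=.
by apply: leq_sum => p _; rewrite perm1; lia.
Qed.

End Bruhat.

(** * Words with prescribed right-to-left minima *)

Section RightMinima.

Variables (n : nat) (S : pred 'I_n).
Implicit Types (x y z : 'S_n) (a b p q : 'I_n).

Definition right_minima_at x : Prop :=
  forall p q, S p -> p < q -> x p < x q.

(** A position of [S] strictly between [a] and [b] carries a letter below [x b], hence below [x a],
    which moves to [b]. If [b] itself is in [S], its letter only decreases. Positions of [S] before
    [a] see the same later letters. *)
Lemma right_minima_tperm x a b : right_minima_at x -> ~~ S a ->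
  a < b -> x a < x b -> (forall p, a < p < b -> ~~ (x a < x p < x b)) ->
  right_minima_at (tperm a b * x)%g.
Proof.
move=> rx nSa ab xab nob p q Sp pq; rewrite !permM.
have nab : a != b by rewrite neq_ltn ab.
have pa : p != a by apply: contraTneq Sp => ->.
have := rx p q Sp pq; have := rx p a Sp; have := rx p b Sp.
have := nob p; move: pq.
have [[ep]|[-> ->]|[npa pb xpa _ ->]] := tperm_cases x p nab;
  first by rewrite ep eqxx in pa.
all: have [[-> ->]|[-> ->]|[qa qb _ _ ->]] := tperm_cases x q nab; lia.
Qed.

Definition saturated x : Prop := forall a b, ~~ S a -> a < b -> x b < x a.

(** The nearest later position with a letter above [x a] serves as [c]. *)
Lemma ascent_cover x a b : a < b -> x a < x b ->
  exists c : 'I_n, [/\ a < c, x a < x c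
    & forall p, a < p < c -> ~~ (x a < x p < x c)].
Proof.
move=> ab xab; have Qb : (a < b) && (x a < x b) by rewrite ab.
have [c /andP[ac xac] min_c] :=
  @arg_minnP _ b (fun c => (a < c) && (x a < x c)) val Qb.
exists c; split=> // p /andP[ap pc]; apply/negP=> /andP[xap _].
by have := min_c p; rewrite ap xap leqNgt pc => /(_ isT).
Qed.

Lemma saturated_above x : right_minima_at x ->
  exists w, [/\ right_minima_at w, saturated w & bruhat_le n x w].
Proof.
elim/inv_ind: x => x IHx rx.
have [/existsP[a /existsP[b /and3P[nSa ab xab]]]|sat] :=
    boolP [exists a, exists b : 'I_n, [&& ~~ S a, a < b & x a < x b]].
  have [c [ac xac noc]] := ascent_cover ab xab.
  have st := bruhat_step_tperm ac xac noc.
  have [|w [rw sw zw]] := IHx _ (inv_step st).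
    exact: right_minima_tperm.
  by exists w; split=> //; apply: connect_trans (connect1 st) zw.
exists x; split=> //; last exact: connect0.
move=> a b nSa ab; rewrite ltn_neqAle (inj_eq val_inj)
  (inj_eq perm_inj) neq_ltn ab orbT leqNgt.
apply: contra sat => xab; apply/existsP; exists a; apply/existsP; exists b.
by rewrite nSa ab.
Qed.

(** At the first difference [a], the letter of each word at [a] occurs later in the other word. The
    two conditions order [a] against later positions in the same way in both words, so [v a] and
    [w a] would each be smaller than the other. *)
Lemma saturated_right_minima_inj v w : right_minima_at v -> saturated v ->
  right_minima_at w -> saturated w -> v = w.
Proof.
move=> rv sv rw sw; apply/eqP/negPn/negP=> /first_difference[a nvwa agree].
have [b ab vb] := position_after_agreement agree nvwa.
have [||c ac wc] := @position_after_agreement _ w v a.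
- by move=> p /agree.
- by rewrite eq_sym.
have [Sa|nSa] := boolP (S a).
  by have := rv a b Sa ab; have := rw a c Sa ac; rewrite vb wc; lia.
by have := sv a b nSa ab; have := sw a c nSa ac; rewrite vb wc; lia.
Qed.

Lemma right_minima_cover_below x y : right_minima_at x -> right_minima_at y ->
  bruhat_le n x y -> x != y ->
  exists z, [/\ right_minima_at z, bruhat_le n x z, bruhat_le n z y
    & inv z = (inv x).+1].
Proof.
move=> rx ry /bruhat_leP dom nxy.
have [a [b [ab xab nob [c ac yca] domz]]] := dominated_exchange dom nxy.
have st := bruhat_step_tperm ab xab nob.
exists (tperm a b * x)%g; split; last exact: inv_step.
(* Were [a] in [S], [y a] would be smaller than the later letter [y c]. *)
- apply: right_minima_tperm => //; apply: contraTN yca => Sa.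
  by have := ry a c Sa ac; lia.
- exact: connect1.
- exact/bruhat_leP.
Qed.

Lemma right_minima1 : right_minima_at 1%g.
Proof. by move=> p q _; rewrite !perm1. Qed.

Lemma right_minima_poset (P : {set 'S_n}) :
  (forall x, x \in P <-> right_minima_at x) ->
  [/\ graded_poset (bruhat_le n) P, is_minimum (bruhat_le n) P 1%g
    & exists M, is_maximum (bruhat_le n) P M].
Proof.
move=> PE.
have min1 : is_minimum (bruhat_le n) P 1%g.
  by split=> [|x _]; [apply/PE; exact: right_minima1 | exact: bruhat_le1].
have [w [rw sw _]] := saturated_above right_minima1.
have maxw : is_maximum (bruhat_le n) P w.
  split=> [|x /PE /saturated_above[v [rv sv xv]]]; first exact/PE.
  by rewrite (saturated_right_minima_inj rw sw rv sv).
split=> //; last by exists w.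
apply: (graded_by_rank (rk := @inv n) _ _ _ _ _ min1 maxw).
- exact: connect0.
- exact: connect_trans.
- by move=> x y /bruhat_le_inv[].
- by move=> x y /bruhat_le_inv[_ e] /eqP; rewrite e => /eqP.
- move=> x y /PE rx /PE ry xy nxy.
  have [z [rz xz zy zk]] := right_minima_cover_below rx ry xy nxy.
  by exists z; split=> //; apply/PE.
Qed.

End RightMinima.

(** * The permutation cycling the letters of each block *)

Section Blocks.

Variable T : eqType.
Implicit Types (F : seq (seq T)) (c d : seq T) (u v : T).

Definition block_of F v : seq T :=
  foldr (fun c r => if v \in c then c else r) [::] F.

Lemma block_ofE F c v :
  uniq (flatten F) -> c \in F -> v \in c -> block_of F v = c.
Proof.
elim: F => //= d F IHF; rewrite cat_uniq inE => /and3P[_ dis UF].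
have [<- _ ->|_ /= Fc cv] := eqVneq c d; first by [].
case: ifP => [dv|_]; last exact: IHF.
by case/hasP: dis; exists v => //; apply/flattenP; exists c.
Qed.

Lemma block_of_mem F v : uniq (flatten F) -> v \in flatten F ->
  (block_of F v \in F) && (v \in block_of F v).
Proof. by move=> UF /flattenP[c Fc cv]; rewrite (block_ofE UF Fc cv) Fc. Qed.

Lemma uniq_block F c : uniq (flatten F) -> c \in F -> uniq c.
Proof.
move=> + Fc; case/splitPr: Fc => F1 F2.
by rewrite flatten_cat cat_uniq /= cat_uniq => /and5P[].
Qed.

(** Since [next] stays inside its block, equal images force equal blocks, and within a
    duplicate-free block [prev] inverts [next]. *)
Lemma block_next_inj F : uniq (flatten F) -> (forall v, v \in flatten F) ->
  injective (fun v => next (block_of F v) v).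
Proof.
move=> UF FT u v /= e.
have /andP[Fu bu] := block_of_mem UF (FT u).
have /andP[Fv bv] := block_of_mem UF (FT v).
have euv : block_of F u = block_of F v.
  have nv : next (block_of F v) v \in block_of F v by rewrite mem_next.
  have nu : next (block_of F v) v \in block_of F u by rewrite -e mem_next.
  exact: etrans (esym (block_ofE UF Fu nu)) (block_ofE UF Fv nv).
have Uu := uniq_block UF Fu.
by rewrite -(prev_next Uu u) e -euv prev_next.
Qed.

End Blocks.

(** * Standard cyclic forms and the description of [C_ n lambda] *)

Section CyclicForm.

Variable n : nat.
Implicit Types (F : seq (seq 'I_n)) (c : seq 'I_n) (s x : 'S_n).

Lemma fconnect_porbit s i j : fconnect s i j = (j \in porbit s i).
Proof.
apply/idP/porbitP=> [/iter_findex <-|[k ->]].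
  by exists (findex s i j); rewrite permX.
by rewrite permX fconnect_iter.
Qed.

Lemma cycle_wordE s h c : fcycle s (h :: c) -> uniq (h :: c) ->
  cycle_word s h = h :: c.
Proof.
move=> cyc U; have hc : h \in h :: c := mem_head h c.
have -> : cycle_word s h = traject s h (size (h :: c)).
  rewrite -(order_cycle cyc U hc); congr traject.
  by apply: eq_card => j; rewrite [RHS]fconnect_porbit.
move: cyc; rewrite /= rcons_path => /andP[/fpathP[k ->] _].
by rewrite size_traject.
Qed.

Lemma mem_heads F h : h \in pmap ohead F -> exists c, h :: c \in F.
Proof.
by rewrite mem_pmap => /mapP[[|a c] Fc //= [->]]; exists c.
Qed.

Lemma map_heads F (f : 'I_n -> seq 'I_n) : [::] \notin F ->
  (forall h c, h :: c \in F -> f h = h :: c) ->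
  [seq f h | h <- pmap ohead F] = F.
Proof.
elim: F => //= -[|h c] F IHF //=; rewrite inE /= => Fne fE.
rewrite (fE h c) ?mem_head // IHF // => h' c' Fc.
by apply: fE; rewrite inE Fc orbT.
Qed.

Lemma sorted_heads F : [::] \notin F ->
  (forall F1 h c F2, F = F1 ++ (h :: c) :: F2 ->
    forall v, v \in c ++ flatten F2 -> h < v) ->
  sorted (fun i j : 'I_n => i < j) (pmap ohead F).
Proof.
elim: F => //= -[|h c] F IHF //=; rewrite inE /= => Fne minF.
rewrite path_sortedE; last by move=> j i k; exact: ltn_trans.
rewrite IHF // ?andbT; last first.
  by move=> F1 h' c' F2 eF; apply: (minF ((h :: c) :: F1)); rewrite eF.
apply/allP=> h' /mem_heads[c' Fc'].
apply: (minF [::] h c F) => //; rewrite mem_cat; apply/orP; right.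
by apply/flattenP; exists (h' :: c'); rewrite ?mem_head.
Qed.

(** Let [s] send each letter to the next one in its block, cyclically. Its cycles are the blocks,
    and each head is the minimum of its block. The heads and the cycle minima are then two strictly
    increasing lists with the same members. *)
Lemma standard_cyclic_form_surj F :
  uniq (flatten F) -> (forall i, i \in flatten F) -> [::] \notin F ->
  (forall F1 h c F2, F = F1 ++ (h :: c) :: F2 ->
    forall v, v \in c ++ flatten F2 -> h < v) ->
  exists s, standard_cyclic_form s = F.
Proof.
move=> UF FT Fne minF; pose s := perm (block_next_inj UF FT).
exists s.
have cycF c : c \in F -> fcycle s c.
  move=> Fc; have Uc := uniq_block UF Fc.
  rewrite (eq_in_cycle (P := [in c]) (e' := frel (next c))) ?cycle_next //.
  by move=> u v cu _ /=; rewrite permE (block_ofE UF Fc).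
have minh h c : h :: c \in F -> forall v, v \in c -> h < v.
  move=> Fc; case/splitPr: Fc minF => F1 F2 minF v cv.
  by apply: (minF F1 h c F2) => //; rewrite mem_cat cv.
have wordF h c : h :: c \in F -> cycle_word s h = h :: c.
  by move=> Fc; apply: cycle_wordE; [exact: cycF | exact: uniq_block Fc].
rewrite -[RHS](map_heads Fne wordF).
congr map; apply: (@irr_sorted_eq _ (fun i j : 'I_n => i < j)).
- by move=> j i k; exact: ltn_trans.
- by move=> i; exact: ltnn.
- apply: sorted_filter; first by move=> j i k; exact: ltn_trans.
  by have := iota_ltn_sorted 0 n; rewrite -val_enum_ord sorted_map.
- exact: sorted_heads.
move=> i; rewrite mem_filter mem_enum andbT.
apply/idP/idP=> [/forall_inP min_i|/mem_heads[c Fc]].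
  have /flattenP[[|h c] Fc] := FT i; first by [].
  rewrite inE => /predU1P[->|ci].
    by rewrite mem_pmap; apply/mapP; exists (h :: c).
  have := minh h c Fc i ci; rewrite ltnNge min_i //.
  by rewrite porbit_sym -mem_cycle_word (wordF h c) // inE ci orbT.
apply/forall_inP=> j; rewrite -mem_cycle_word (wordF i c) // inE.
by case/predU1P=> [->//|/(minh i c Fc)/ltnW].
Qed.

(** The encoding by [reshape_offset] matches [nth_flatten], which reads letters off a flattened
    cyclic form. *)
Definition block_start (lambda : seq nat) (p : 'I_n) : bool :=
  reshape_offset lambda p == 0.

Lemma nth_one_line x (i0 p : 'I_n) : nth i0 (one_line x) p = x p.
Proof. by rewrite (nth_map i0) ?size_enum_ord // nth_ord_enum. Qed.

Lemma one_line_inj : injective (@one_line n).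
Proof.
by move=> x y e; apply/permP=> p; rewrite -!(nth_one_line _ p) e.
Qed.

Lemma size_one_line x : size (one_line x) = n.
Proof. by rewrite size_map size_enum_ord. Qed.

(** A block start carries the minimum of its cycle. A later letter lies in the same or a later
    cycle, whose minimum is at least as large. *)
Lemma Omega_right_minima s :
  right_minima_at (block_start (composition_type s)) (Omega s).
Proof.
move=> p q /eqP p0 pq.
have neq : Omega s p != Omega s q :> nat.
  by rewrite (inj_eq val_inj) (inj_eq perm_inj) neq_ltn pq.
rewrite ltn_neqAle neq /=.
rewrite -[Omega s p](nth_one_line _ p) -[Omega s q](nth_one_line _ p).
rewrite one_line_Omega /cyclic_word !nth_flatten -/(composition_type s) p0.
set r := reshape_index _ p; set r' := reshape_index _ q.
pose L := [seq i <- enum 'I_n | is_cycle_min s i].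
have lt_sum (k : 'I_n) : k < sumn (composition_type s).
  by rewrite -size_flatten (eqP (size_cyclic_word s)).
have ltL (k : 'I_n) : reshape_index (composition_type s) k < size L.
  by have := reshape_indexP (lt_sum k); rewrite !size_map.
have nthF k : k < size L ->
    nth [::] (standard_cyclic_form s) k = cycle_word s (nth p L k).
  exact: nth_map.
have Lr : nth p L r <= nth p L r'.
  apply: (@sorted_leq_nth _ (fun i j : 'I_n => i <= j)) => //; try exact: ltL.
  - by move=> j i k; exact: leq_trans.
  - apply: sorted_filter; first by move=> j i k; exact: leq_trans.
    by have := iota_sorted 0 n; rewrite -val_enum_ord sorted_map.
  have := ltnW pq; rewrite (reshape_leq (composition_type s)) -/r -/r'.
  by case/orP=> [/ltnW//|/andP[/eqP-> _]].
have off : reshape_offset (composition_type s) q <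
    size (nth [::] (standard_cyclic_form s) r').
  have := reshape_offsetP (lt_sum q); rewrite (nth_map [::]) //.
  by rewrite -[ltnRHS](size_map size) reshape_indexP.
rewrite !nthF ?ltL // in off *.
have -> : nth p (cycle_word s (nth p L r)) 0 = nth p L r.
  have : 0 < #|porbit s (nth p L r)|.
    by apply/card_gt0P; exists (nth p L r); rewrite porbit_id.
  by rewrite /cycle_word; case: #|_|.
apply: leq_trans Lr _.
have : nth p L r' \in L by rewrite mem_nth ?ltL.
rewrite mem_filter => /andP[/forall_inP min_r' _].
by apply: min_r'; rewrite -mem_cycle_word mem_nth.
Qed.

Lemma right_minima_Omega lambda x : is_composition n lambda ->
  right_minima_at (block_start lambda) x ->
  exists2 s, composition_type s = lambda & Omega s = x.
Proof.
case/andP=> pos_l /eqP sum_l rx.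
pose F := reshape lambda (one_line x).
have shF : shape F = lambda by rewrite reshapeKl // sum_l size_one_line.
have flF : flatten F = one_line x by rewrite reshapeKr // sum_l size_one_line.
have [||||s sF] := @standard_cyclic_form_surj F.
- by rewrite flF map_inj_uniq ?enum_uniq //; exact: perm_inj.
- by move=> i; rewrite flF; apply/mapP; exists (x^-1 i)%g;
    rewrite ?mem_enum ?permKV.
- apply/negP=> F0; have /allP/(_ 0) := pos_l.
  by rewrite -shF => /(_ (map_f size F0)).
- move=> F1 h c F2 eF v /(nthP h)[k ltk <-].
  have eW : one_line x = flatten F1 ++ h :: (c ++ flatten F2).
    by rewrite -flF eF flatten_cat.
  have := size_one_line x; rewrite eW size_cat /= => sz.
  have ltp : size (flatten F1) < n by lia.
  have ltq : size (flatten F1) + k.+1 < n by rewrite -[ltnRHS]sz ltn_add2l.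
  have xp : x (Ordinal ltp) = h.
    by rewrite -(nth_one_line x h) eW nth_cat ltnn subnn.
  have xq : x (Ordinal ltq) = nth h (c ++ flatten F2) k.
    by rewrite -(nth_one_line x h) eW nth_cat ltnNge leq_addr addKn.
  suff: x (Ordinal ltp) < x (Ordinal ltq) by rewrite xp xq.
  apply: rx => /=; last by rewrite -addn1 leq_add2l.
  (* The block [h :: c] is nonempty, so the position [size (flatten F1)] has offset 0 in block
     number [size F1]. *)
  have : 0 < nth 0 (shape F) (size F1).
    by rewrite eF /shape map_cat nth_cat size_map ltnn subnn.
  move/flatten_indexKr; rewrite /block_start -shF /flatten_index addn0.
  suff -> : sumn (take (size F1) (shape F)) = size (flatten F1) by move=> ->.
  by rewrite size_flatten eF /shape map_cat -(size_map size F1) take_size_cat.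
exists s; first by rewrite /composition_type sF.
by apply: one_line_inj; rewrite one_line_Omega /cyclic_word sF.
Qed.

Lemma mem_C lambda x : is_composition n lambda ->
  x \in C_ n lambda <-> right_minima_at (block_start lambda) x.
Proof.
move=> comp; split=> [/imsetP[s]|/(right_minima_Omega comp)[s <- <-]].
  by rewrite inE => /eqP <- ->; exact: Omega_right_minima.
by apply/imsetP; exists s; rewrite ?inE.
Qed.

End CyclicForm.

Theorem theoremA (n : nat) (lambda : seq nat)
    (lambda_comp : is_composition n lambda) :
  [/\ graded_poset (bruhat_le n) (C_ n lambda),
      exists! m : 'S_n, is_minimum (bruhat_le n) (C_ n lambda) m
    & exists! M : 'S_n, is_maximum (bruhat_le n) (C_ n lambda) M].
Proof.
have [gr [m1 min1] [M [CM maxM]]] :=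
  right_minima_poset (fun x => mem_C x lambda_comp).
have [[_ anti _] _] := gr.
split=> //.
  by exists 1%g; split=> // m [Cm minm]; apply: anti; rewrite // min1 ?minm.
by exists M; split=> // M' [CM' maxM']; apply: anti; rewrite // maxM ?maxM'.
Qed.
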